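(* Let $B_1,B_2$ be Boolean algebras. Every homomorphism $\varphi:B_1\to B_2$ induces a continuous map $\widetilde{\varphi}:\mathcal{U}(B_2)\to \mathcal{U}(B_1)$ between the associated Stone's spaces. If, moreover, $\varphi:B_1\to B_2$ is an isomorphism, then its induced map $\widetilde{\varphi}:\mathcal{U}(B_2)\to \mathcal{U}(B_1)$ is a homeomorphism.
   Context: A Boolean algebra $(B,+,\cdot,\neg)$ is written with join $+$, meet $\cdot$ and complement $\neg$, with bottom $0$ and top $1$; $x\leqslant y$ means $x+y=y$. A homomorphism of Boolean algebras is a map preserving $+$, $\cdot$, $0$ and $1$. A filter of $B$ is a nonempty subset $F\subset B$ closed under $\cdot$ and upward closed for $\leqslant$; it is proper if $F\neq B$. An ultrafilter of $B$ is a proper filter $F$ such that for every $x\in B$ exactly one of $x,\neg x$ lies in $F$. $\mathcal{U}(B)$ denotes the set of all ultrafilters of $B$, with the topology having as a basis the sets $U_x=\{F\in\mathcal{U}(B):x\in F\}$, $x\in B$; this is the Stone's space associated with $B$. The map induced by a homomorphism $\varphi:B_1\to B_2$ is $\widetilde{\varphi}(F)=\varphi^{-1}(F)$ for $F\in\mathcal{U}(B_2)$. *)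

(* Defs.v *)
From HB Require Import structures.
From mathcomp Require Import all_boot all_order.
From mathcomp Require Import boolp classical_sets filter topology.

Set Implicit Arguments.
Unset Strict Implicit.
Unset Printing Implicit Defensive.

Local Open Scope classical_set_scope.

(* Boolean algebras are MathComp's [ctbDistrLatticeType]s: x + y is
   [(x `|` y)%O], x . y is [(x `&` y)%O] and the complement is [(~` x)%O]; the
   order satisfies x <= y iff x + y = y ([Order.JoinTheory.leEjoin]).  The algebra
   in which 0 = 1 is allowed. *)

Section Filters.
Context {d : Order.disp_t} {B : ctbDistrLatticeType d}.
Implicit Type F : set B.

Definition boolean_filter F : Prop :=
  [/\ F !=set0,
      forall x y, F x -> F y -> F (x `&` y)%O &
      forall x y, F x -> (x <= y)%O -> F y].

Definition boolean_ultrafilter F : Prop :=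
  [/\ boolean_filter F,
      F <> setT &
      forall x, (F x /\ ~ F (~` x)%O) \/ (~ F x /\ F (~` x)%O)].

End Filters.

Record stone_space {d : Order.disp_t} (B : ctbDistrLatticeType d) : Type :=
  StoneSpace {
    stone_set :> set B ;
    stone_setP : boolean_ultrafilter stone_set
  }.

Section StoneTopology.
Context {d : Order.disp_t} (B : ctbDistrLatticeType d).

HB.instance Definition _ := gen_eqMixin (stone_space B).
HB.instance Definition _ := gen_choiceMixin (stone_space B).

Definition stone_basic (x : B) : set (stone_space B) :=
  [set F : stone_space B | (F : set B) x].

(* The base is indexed by the sets U_x themselves because the index type of
   [isBaseTopological] must be pointed, and B is not canonically so. *)
Let stone_cover : \bigcup_(U in range stone_basic) U = setT.
Proof.
apply/seteqP; split=> // F _.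
have [[[x Fx] _ _] _ _] := stone_setP F.
by exists (stone_basic x) => //; exists x.
Qed.

Let stone_join (U V : set (stone_space B)) (F : stone_space B) :
  range stone_basic U -> range stone_basic V -> U F -> V F ->
  exists W, [/\ range stone_basic W, W F & W `<=` U `&` V].
Proof.
move=> [x _ <-] [y _ <-] Fx Fy; exists (stone_basic (x `&` y)%O); split.
- by exists (x `&` y)%O.
- by have [[_ FI _] _ _] := stone_setP F; exact: FI.
- move=> G Gxy; have [[_ _ Gup] _ _] := stone_setP G.
  by split; apply: Gup Gxy _; rewrite ?Order.MeetTheory.leIl ?Order.MeetTheory.leIr.
Qed.

HB.instance Definition _ :=
  @isBaseTopological.Build (stone_space B) (set (stone_space B))
    (range stone_basic) id stone_cover stone_join.

End StoneTopology.

Definition homeomorphism {X Y : topologicalType} (f : X -> Y) : Prop :=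
  continuous f /\
  exists g : Y -> X, [/\ cancel f g, cancel g f & continuous g].

(* Not [{tblmorphism B1 -> B2}], which in MathComp only requires preservation of
   \bot and \top. *)
Definition boolean_morphism {d1 d2 : Order.disp_t}
    {B1 : ctbDistrLatticeType d1} {B2 : ctbDistrLatticeType d2}
    (phi : B1 -> B2) : Prop :=
  [/\ Order.join_morphism phi,
      Order.meet_morphism phi,
      phi \bot%O = \bot%O &
      phi \top%O = \top%O].

(* The inverse of a bijective morphism is automatically a morphism. *)
Definition boolean_isomorphism {d1 d2 : Order.disp_t}
    {B1 : ctbDistrLatticeType d1} {B2 : ctbDistrLatticeType d2}
    (phi : B1 -> B2) : Prop :=
  boolean_morphism phi /\ bijective phi.

(* [f] is the map F |-> phi^-1(F); that phi^-1(F) is again an ultrafilter is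
   part of the existence of such an [f], which is then unique. *)
Definition induced_map {d1 d2 : Order.disp_t}
    {B1 : ctbDistrLatticeType d1} {B2 : ctbDistrLatticeType d2}
    (phi : B1 -> B2) (f : stone_space B2 -> stone_space B1) : Prop :=
  forall F : stone_space B2, (f F : set B1) = phi @^-1` (F : set B2).

(* Main.v *)
Require Import Defs.
From mathcomp Require Import all_boot all_order.
From mathcomp Require Import boolp classical_sets filter topology.

(** A homomorphism preserves complements, so the preimage of an ultrafilter
    still contains exactly one of [x] and [~` x] for every [x]
    ([boolean_ultrafilter_preimage]): taking preimages is a map of Stone spaces.
    The preimage of the basic open set of [x] under this map is the basic open
    set of [phi x], which gives continuity ([induced_map_continuous]).  The
    construction is contravariant: maps induced by mutually inverse homomorphisms
    are mutually inverse ([induced_map_cancel]).  When [phi] is bijective, its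
    inverse is a homomorphism too, so the map that it induces is a continuous
    inverse of the map induced by [phi]. *)

Import Order.Theory.
Local Open Scope classical_set_scope.

Lemma compl_unique {d : Order.disp_t} {B : ctbDistrLatticeType d} (a b : B) :
  (a `&` b = \bot -> a `|` b = \top -> b = ~` a)%O.
Proof.
move=> ab0 ab1.
by rewrite -[b]meet1x -(joinxC a) meetUl ab0 join0x -[RHS]meetx1 -ab1 meetUr
           meetCx join0x.
Qed.

(** [phi (~` x)] has meet [\bot] and join [\top] with [phi x], which
    characterizes the complement in a distributive lattice. *)
Lemma boolean_morphism_compl {d1 d2 : Order.disp_t}
    {B1 : ctbDistrLatticeType d1} {B2 : ctbDistrLatticeType d2}
    (phi : B1 -> B2) (x : B1) :
  boolean_morphism phi -> (phi (~` x) = ~` phi x)%O.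
Proof.
move=> [phiU phiI phi0 phi1].
by apply: compl_unique; [rewrite -phiI meetxC | rewrite -phiU joinxC].
Qed.

Lemma boolean_ultrafilter_preimage {d1 d2 : Order.disp_t}
    {B1 : ctbDistrLatticeType d1} {B2 : ctbDistrLatticeType d2}
    (phi : B1 -> B2) (F : set B2) :
  boolean_morphism phi -> boolean_ultrafilter F ->
  boolean_ultrafilter (phi @^-1` F).
Proof.
move=> phiM [[[y Fy] FI Fup] _ Fultra].
have [phiU phiI phi0 phi1] := phiM.
have preultra x : (F (phi x) /\ ~ F (phi (~` x)%O)) \/
                  (~ F (phi x) /\ F (phi (~` x)%O)).
  by rewrite (boolean_morphism_compl _ _ phiM).
split=> //.
- split.
  + by exists \top%O; rewrite /= phi1; apply: Fup Fy _; rewrite lex1.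
  + by move=> x z Fx Fz; rewrite /= phiI; apply: FI.
  + by move=> x z Fx /join_r xz; apply: Fup Fx _; rewrite -xz phiU leUl.
- (* The whole algebra would contain both [\top] and its complement. *)
  move=> FT; have inF z : F (phi z) by have : (phi @^-1` F) z by rewrite FT.
  by case: (preultra \top%O) => -[].
Qed.

Lemma stone_set_inj {d : Order.disp_t} {B : ctbDistrLatticeType d}
    (F G : stone_space B) : (F : set B) = G -> F = G.
Proof.
case: F G => [F Fu] [G Gu] /= FG; subst G.
by congr StoneSpace; exact: Prop_irrelevance.
Qed.

Lemma stone_basic_open {d : Order.disp_t} {B : ctbDistrLatticeType d} (x : B) :
  open (stone_basic x).
Proof.
exists [set stone_basic x]; last by rewrite bigcup_set1.
by move=> _ ->; exists x.
Qed.

Lemma ex_induced_map {d1 d2 : Order.disp_t}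
    {B1 : ctbDistrLatticeType d1} {B2 : ctbDistrLatticeType d2}
    {phi : B1 -> B2} :
  boolean_morphism phi ->
  exists f : stone_space B2 -> stone_space B1, induced_map phi f.
Proof.
move=> phiM.
by exists (fun F =>
  StoneSpace (boolean_ultrafilter_preimage phi _ phiM (stone_setP F))).
Qed.

(** [f] pulls the basic open set of [x] back to the basic open set of [phi x],
    and preimages commute with unions. *)
Lemma induced_map_continuous {d1 d2 : Order.disp_t}
    {B1 : ctbDistrLatticeType d1} {B2 : ctbDistrLatticeType d2}
    {phi : B1 -> B2} {f : stone_space B2 -> stone_space B1} :
  induced_map phi f -> continuous f.
Proof.
move=> fE; apply/continuousP => _ [D DS <-].
rewrite preimage_bigcup; apply: bigcup_open => U /DS [x _ <-].
suff -> : f @^-1` stone_basic x = stone_basic (phi x) by exact: stone_basic_open.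
by apply/seteqP; split=> F; rewrite /stone_basic /= fE.
Qed.

Lemma induced_map_cancel {d1 d2 : Order.disp_t}
    {B1 : ctbDistrLatticeType d1} {B2 : ctbDistrLatticeType d2}
    {phi : B1 -> B2} {psi : B2 -> B1}
    {f : stone_space B2 -> stone_space B1}
    {g : stone_space B1 -> stone_space B2} :
  induced_map phi f -> induced_map psi g -> cancel psi phi -> cancel f g.
Proof.
move=> fE gE psiK F; apply: stone_set_inj; rewrite gE fE.
by apply/seteqP; split=> y; rewrite /= psiK.
Qed.

Lemma boolean_morphism_inverse {d1 d2 : Order.disp_t}
    {B1 : ctbDistrLatticeType d1} {B2 : ctbDistrLatticeType d2}
    {phi : B1 -> B2} {psi : B2 -> B1} :
  boolean_morphism phi -> cancel phi psi -> cancel psi phi ->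
  boolean_morphism psi.
Proof.
move=> [phiU phiI phi0 phi1] phiK psiK; have phi_inj := can_inj phiK.
by split=> [x y|x y||]; apply: phi_inj; rewrite ?phiU ?phiI ?phi0 ?phi1 !psiK.
Qed.

Theorem theorem3p29 (d1 d2 : Order.disp_t)
    (B1 : ctbDistrLatticeType d1) (B2 : ctbDistrLatticeType d2)
    (phi : B1 -> B2) :
  boolean_morphism phi ->
  exists f : stone_space B2 -> stone_space B1,
    [/\ induced_map phi f,
        continuous f &
        boolean_isomorphism phi -> homeomorphism f].
Proof.
move=> phiM; have [f fE] := ex_induced_map phiM.
exists f; split=> [//||[_ [psi phiK psiK]]]; first exact: induced_map_continuous fE.
have [g gE] := ex_induced_map (boolean_morphism_inverse phiM phiK psiK).
split; first exact: induced_map_continuous fE.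
exists g; split; last exact: induced_map_continuous gE.
- exact: induced_map_cancel fE gE psiK.
- exact: induced_map_cancel gE fE phiK.
Qed.
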